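(* Let $\{f_t(\mathbf{x})\}_{t\in[0,1]}\subseteq\mathbb{R}[\mathbf{x}]_{n,2d}$ satisfy $f_t\in C_{n,2d}$ for all $t\in[0,1]$. Assume moreover that $t\mapsto f_t$ is Riemann integrable as a map into the finite-dimensional coefficient space $\mathbb{R}[\mathbf{x}]_{n,2d}$; equivalently, all coefficient functions of $f_t$ are Riemann integrable on $[0,1]$. Then $$p(\mathbf{x}):=\int_0^1 f_t(\mathbf{x})\,dt\in C_{n,2d}.$$
   Context: $\mathbb{R}[\mathbf{x}]_{n,2d}$ is the space of real polynomials in $n$ variables of degree at most $2d$; $\mathbb{N}$ contains $0$. The integral is taken coefficient-wise. SONC cone: A circuit $(S,\boldsymbol\beta)$ consists of a finite affinely independent set $S\subseteq\mathbb{N}^n$ and a point $\boldsymbol\beta\in\mathbb{N}^n\setminus S$ in the relative interior of $\mathrm{conv}(S)$. A monomial square is a term $c\,\mathbf{x}^{\boldsymbol\alpha}$ with $c\ge0$ and $\boldsymbol\alpha\in 2\mathbb{N}^n$. A circuit polynomial is a polynomial that is either a sum of monomial squares or of the form $\sum_{\boldsymbol\alpha\in S}c_{\boldsymbol\alpha}\mathbf{x}^{\boldsymbol\alpha}+\delta\,\mathbf{x}^{\boldsymbol\beta}$ with $(S,\boldsymbol\beta)$ a circuit, $S\subseteq 2\mathbb{N}^n$, all $c_{\boldsymbol\alpha}>0$ and $\delta\in\mathbb{R}$. A polynomial is SONC if it is a finite conic combination of circuit polynomials that are nonnegative on $\mathbb{R}^n$. $C_{n,2d}$ is the cone of all SONC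 polynomials in $\mathbb{R}[\mathbf{x}]_{n,2d}$. *)

(* Defs.v *)
From HB Require Import structures.
From Stdlib Require Import Reals.
From mathcomp Require Import all_boot all_order all_algebra.
From mathcomp Require Import finmap.
From mathcomp Require Export mpoly.
From mathcomp Require Export Rstruct.
From Coquelicot Require Import Hierarchy.
From Coquelicot Require Export RInt.

Set Implicit Arguments.
Unset Strict Implicit.
Unset Printing Implicit Defensive.

Import Order.TTheory GRing.Theory Num.Theory.
Local Open Scope ring_scope.

Section ConvexGeometry.
Variable n : nat.
Implicit Types (A : 'rV[R]_n -> Prop) (x y : 'rV[R]_n).

Definition aff_hull A x : Prop :=
  exists (k : nat) (v : 'I_k -> 'rV[R]_n) (lam : 'I_k -> R),
    [/\ forall i, A (v i),
        \sum_(i < k) lam i = 1 &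
        x = \sum_(i < k) lam i *: v i].

Definition conv_hull A x : Prop :=
  exists (k : nat) (v : 'I_k -> 'rV[R]_n) (lam : 'I_k -> R),
    [/\ forall i, A (v i),
        forall i, 0 <= lam i,
        \sum_(i < k) lam i = 1 &
        x = \sum_(i < k) lam i *: v i].

(* Interior of A relative to its affine hull; the neighbourhoods are the open
   cubes, which generate the usual topology of R^n. *)
Definition rel_interior A x : Prop :=
  A x /\
  exists2 eps : R, 0 < eps &
    forall y, aff_hull A y -> (forall i, `|y 0 i - x 0 i| < eps) -> A y.

End ConvexGeometry.

Definition expo_pt (n : nat) (a : 'X_{1..n}) : 'rV[R]_n :=
  \row_i (a i)%:R.

Definition expo_set (n : nat) (S : {fset 'X_{1..n}}) (x : 'rV[R]_n) : Prop :=
  exists2 a, a \in S & x = expo_pt a.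

Definition aff_indep (n : nat) (S : {fset 'X_{1..n}}) : Prop :=
  forall lam : 'X_{1..n} -> R,
    \sum_(a <- S) lam a = 0 ->
    \sum_(a <- S) lam a *: expo_pt a = 0 ->
    forall a, a \in S -> lam a = 0.

Definition circuit (n : nat) (S : {fset 'X_{1..n}}) (b : 'X_{1..n}) : Prop :=
  [/\ aff_indep S, b \notin S &
      rel_interior (conv_hull (expo_set S)) (expo_pt b)].

Definition even_expo (n : nat) (a : 'X_{1..n}) : Prop :=
  forall i, ~~ odd (a i).

Definition monomial_square (n : nat) (g : {mpoly R[n]}) : Prop :=
  exists (c : R) (a : 'X_{1..n}),
    [/\ 0 <= c, even_expo a & g = c *: 'X_[a]].

Definition sum_of_monomial_squares (n : nat) (g : {mpoly R[n]}) : Prop :=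
  exists2 s : seq {mpoly R[n]},
    forall q, q \in s -> monomial_square q & g = \sum_(q <- s) q.

Definition circuit_poly (n : nat) (g : {mpoly R[n]}) : Prop :=
  sum_of_monomial_squares g \/
  exists (S : {fset 'X_{1..n}}) (b : 'X_{1..n}) (c : 'X_{1..n} -> R) (delta : R),
    [/\ circuit S b,
        forall a, a \in S -> even_expo a,
        forall a, a \in S -> 0 < c a &
        g = \sum_(a <- S) c a *: 'X_[a] + delta *: 'X_[b]].

Definition nonneg_poly (n : nat) (g : {mpoly R[n]}) : Prop :=
  forall x : 'I_n -> R, 0 <= g.@[x].

Definition SONC (n : nat) (p : {mpoly R[n]}) : Prop :=
  exists2 s : seq (R * {mpoly R[n]}),
    forall u, u \in s -> [/\ 0 <= u.1, circuit_poly u.2 & nonneg_poly u.2] &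
    p = \sum_(u <- s) u.1 *: u.2.

(* [msize p] is 1 + the degree of p, and [msize 0 = 0]. *)
Definition deg_le (n k : nat) (p : {mpoly R[n]}) : Prop := (msize p <= k.+1)%N.

Definition SONC_cone (n k : nat) (p : {mpoly R[n]}) : Prop :=
  deg_le k p /\ SONC p.

Definition poly_ex_RInt (n : nat) (f : R -> {mpoly R[n]}) (a b : R) : Prop :=
  forall m : 'X_{1..n}, ex_RInt (fun t => (f t)@_m) a b.

(* The coefficient-wise integral of a family of polynomials of degree at most
   k.  Truncating at degree k makes the sum finite; by [mcoeff_poly_RInt] it
   loses nothing when the family does have degree at most k on [a, b]. *)
Definition poly_RInt (n k : nat) (f : R -> {mpoly R[n]}) (a b : R) :
    {mpoly R[n]} :=
  \sum_(m : 'X_{1..n < k.+1}) RInt (fun t => (f t)@_m) a b *: 'X_[m].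

Lemma mcoeff_poly_RInt (n k : nat) (f : R -> {mpoly R[n]}) (a b : R)
    (m : 'X_{1..n}) :
  a <= b -> (forall t, a <= t <= b -> deg_le k (f t)) ->
  (poly_RInt k f a b)@_m = RInt (fun t => (f t)@_m) a b.
Proof.
move=> le_ab degf; rewrite /poly_RInt raddf_sum /=.
have [lt_m|le_m] := ltnP (mdeg m) k.+1.
  rewrite (bigD1 (BMultinom lt_m)) //= big1 ?addr0 => [|i ne_im].
    by rewrite mcoeffZ mcoeffX eqxx mulr1.
  rewrite mcoeffZ mcoeffX; case: eqP => [eq_im|_]; last by rewrite mulr0.
  by case/eqP: ne_im; apply: val_inj.
rewrite big1 => [|i _]; last first.
  rewrite mcoeffZ mcoeffX; case: eqP => [eq_im|_]; last by rewrite mulr0.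
  by have := bmdeg i; rewrite eq_im ltnNge le_m.
rewrite (RInt_ext _ (fun=> R0 : R_CompleteNormedModule)) => [|t].
  by rewrite RInt_const /scal /= /mult /= Rmult_0_r.
move/RleP: (le_ab) => le_ab'.
rewrite Rmin_left // Rmax_right // => -[/RltP lt_at /RltP lt_tb].
apply: memN_msupp_eq0; apply/negP => /msize_mdeg_lt lt_m.
have := degf t; rewrite !ltW // /deg_le => /(_ isT) le_ft.
by have := leq_trans lt_m (leq_trans le_ft le_m); rewrite ltnn.
Qed.

(* Main.v *)
Require Import Defs.
From Stdlib Require Import Reals.
From mathcomp Require Import all_boot all_order all_algebra.
From mathcomp Require Import ring lra boolp.
From Coquelicot Require Import Hierarchy SF_seq Rcomplements.

Import Order.TTheory GRing.Theory Num.Theory.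
Local Open Scope ring_scope.

Set Implicit Arguments.
Unset Strict Implicit.
Unset Printing Implicit Defensive.

(** The SONC polynomials of degree at most [k] form a convex cone, and in
    finite dimension the Riemann integral [p] of a map [g] with values in a
    convex cone [K] lies in [K] ([RInt_in_convex_cone]).

    Riemann sums are conic combinations of values of [g] and converge to [p];
    this alone puts [p] in the closure of [K]. To get into [K] itself, the
    error of a Riemann sum has to be absorbed in a conic combination. Let [D]
    be the set of points at which all coordinates of [g] are continuous.
    Riemann integrability makes [D] dense ([common_continuity_pts_dense]), by
    nested intervals of vanishing oscillation. Choose [t_1, ..., t_r] in [D]
    such that the [g (t_j)] form a basis of the span of [g] over [D]. Taking
    the tags of Riemann sums in [D] shows that [p] lies in that span
    ([RInt_in_span]), so the error of such a Riemann sum is a small combination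
    of the [g (t_j)], with coefficients of either sign. On the other hand, near
    [t_j] the coordinates of [g] in this basis are close to the [j]-th unit
    vector, by continuity. A fixed proportion of the weight of the Riemann sum
    sits near each [t_j]; rewriting a part of that weight in the basis yields a
    combination of the [g (t_j)] whose coefficients are bounded below by a
    positive constant independent of the subdivision, and this outweighs the
    error once the subdivision is fine enough. Only values at points of [D] are
    ever used, because a value of [g] on a negligible set, which may lie
    outside the span, carries no weight in the integral. *)

(** * Riemann sums over uniform subdivisions *)

Fixpoint uniform_subdiv (x h : R) (N : nat) (s : nat -> R) : @SF_seq R :=
  if N is N'.+1
  then SF_cons (x, s 0%N) (uniform_subdiv (x + h) h N' (fun k => s k.+1))
  else SF_nil x.

Lemma SF_h_uniform_subdiv x h N s : SF_h (uniform_subdiv x h N s) = x.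
Proof. by case: N. Qed.

Lemma last_uniform_subdiv x h N s :
  last (SF_h (uniform_subdiv x h N s)) (SF_lx (uniform_subdiv x h N s)) =
  x + N%:R * h.
Proof.
elim: N x s => [|N IHN] x s; first by rewrite /= mul0r addr0.
have := IHN (x + h) (fun k => s k.+1).
rewrite [uniform_subdiv _ _ N.+1 _]/= SF_lx_cons /= => ->.
by rewrite -addrA -natr1 mulrDl mul1r [h + _]addrC.
Qed.

Lemma seq_step_uniform_subdiv x h N s :
  0 <= h -> seq_step (SF_lx (uniform_subdiv x h N s)) <= h.
Proof.
move=> h0; elim: N x s => [|N IHN] x s; first by [].
have := IHN (x + h) (fun k => s k.+1).
rewrite /seq_step [uniform_subdiv _ _ N.+1 _]/= SF_lx_cons.
case E: (uniform_subdiv (x + h) h N (fun k => s k.+1)) => [y t].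
have := SF_h_uniform_subdiv (x + h) h N (fun k => s k.+1).
rewrite E /= => -> le_h; apply/RleP/Rmax_lub; last exact/RleP.
by apply/RleP; rewrite RabsE RminusE addrC addKr ger0_norm.
Qed.

Lemma pointed_uniform_subdiv x h N s :
  (forall k, (k < N)%N -> x + k%:R * h <= s k <= x + k.+1%:R * h) ->
  pointed_subdiv (uniform_subdiv x h N s).
Proof.
elim: N x s => [|N IHN] x s Hs; first by move=> i /ssrnat.ltP.
have /IHN ptd : forall k, (k < N)%N ->
    x + h + k%:R * h <= s k.+1 <= x + h + k.+1%:R * h.
  move=> k ltkN; have := Hs k.+1 ltkN; rewrite -!natr1; lra.
case=> [|i] lt_i; last first.
  by have /= := ptd i; apply; apply/ssrnat.ltP; move/ssrnat.ltP: lt_i.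
have /= := Hs 0%N isT; rewrite mul0r mul1r addr0 => /andP[/RleP ? /RleP ?].
by rewrite SF_h_uniform_subdiv.
Qed.

Lemma Riemann_sum_uniform_subdiv (f : R -> R) x h N s :
  Riemann_sum f (uniform_subdiv x h N s) = h * \sum_(k < N) f (s k).
Proof.
elim: N x s => [|N IHN] x s; first by rewrite big_ord0 mulr0.
rewrite [uniform_subdiv _ _ N.+1 _]/= Riemann_sum_cons IHN SF_h_uniform_subdiv.
rewrite big_ord_recl mulrDr /plus /scal /= /mult /= !RplusE RmultE RminusE.
by rewrite (addrC x h) addrK.
Qed.

Definition in_cells (a b : R) (N : nat) (s : 'I_N -> R) : Prop :=
  forall k : 'I_N, a + k%:R * ((b - a) / N%:R) <= s k
                   <= a + k.+1%:R * ((b - a) / N%:R).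

(** Convergence of Riemann sums along filters of pointed subdivisions, brought
    down to uniform subdivisions: the bound holds for every choice of tags,
    which is what later allows tags in a dense set. *)
Lemma uniform_Riemann_sum_cvg (f : R -> R) (a b I : R) :
  a < b -> is_RInt f a b I -> forall e : R, 0 < e ->
  exists N0 : nat, forall N, (N0 < N)%N -> forall s : 'I_N -> R,
    in_cells a b s -> `|(b - a) / N%:R * (\sum_(k < N) f (s k)) - I| < e.
Proof.
move=> ltab If e e0.
have /RltP e0' := e0.
have locI : locally I (fun y => `|y - I| < e).
  by exists (mkposreal e e0') => y /RltP; rewrite -RabsE.
have [[d d0'] /= Hd] := If _ locI.
have /RltP d0 := d0'.
pose N0 := Num.Def.archi_bound ((b - a) / d).
exists N0 => -[|N] // ltN s Hs.
have hN : (b - a) / N.+1%:R < d.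
  rewrite ltr_pdivrMr ?ltr0Sn // mulrC -ltr_pdivrMr //.
  have := archi_boundP (x := (b - a) / d); rewrite divr_ge0 ?subr_ge0 ?ltW //.
  move=> /(_ isT) /lt_trans; apply; rewrite ltr_nat //.
have h0 : 0 <= (b - a) / N.+1%:R by rewrite divr_ge0 ?subr_ge0 // ltW.
pose ptd := uniform_subdiv a ((b - a) / N.+1%:R) N.+1 (fun k => s (inord k)).
have := Hd ptd; rewrite Riemann_sum_uniform_subdiv sign_eq_1; last first.
  by apply/RltP; rewrite RminusE subr_gt0.
rewrite /scal /= /mult /= RmultE mul1r.
under eq_bigr => i _ do rewrite inord_val.
apply.
  by apply/RltP; apply: le_lt_trans hN; apply: seq_step_uniform_subdiv.
have leab : Rle a b by apply/RleP/ltW.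
split; last split; rewrite ?SF_h_uniform_subdiv ?Rmin_left ?Rmax_right //.
  apply: pointed_uniform_subdiv => k ltkN.
  by have := Hs (inord k); rewrite inordK.
have := last_uniform_subdiv a ((b - a) / N.+1%:R) N.+1 (fun k => s (inord k)).
rewrite /= SF_h_uniform_subdiv => ->.
by rewrite mulrCA divff ?pnatr_eq0 // mulr1 addrC subrK.
Qed.

(** * Common continuity points of integrable functions *)

Definition osc_le (f : R -> R) (c d e : R) : Prop :=
  forall x y, c <= x <= d -> c <= y <= d -> `|f x - f y| <= e.

Lemma ex_RInt_subinterval (f : R -> R) (a c d b : R) :
  a <= c -> c <= d -> d <= b -> ex_RInt f a b -> ex_RInt f c d.
Proof.
move=> /RleP ac /RleP cd /RleP db fab.
apply: (@ex_RInt_Chasles_2 _ _ a) => //.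
by apply: (@ex_RInt_Chasles_1 _ _ _ _ b) => //; split=> //; apply: Rle_trans cd.
Qed.

(** If every cell of a uniform subdivision contained two points where [f]
    differs by more than [e], then tagging with the larger and with the smaller
    value would give Riemann sums more than [(b - a) * e] apart, however fine
    the subdivision. *)
Lemma small_osc_subinterval (f : R -> R) (a b e : R) :
  a < b -> ex_RInt f a b -> 0 < e ->
  exists c d, [/\ a < c, c < d, d < b & osc_le f c d e].
Proof.
move=> ab [I fI] e0; apply: contrapT => no.
have e'0 : 0 < (b - a) * e / 2 by rewrite divr_gt0 ?mulr_gt0 ?subr_gt0.
have [N0 cvg] := uniform_Riemann_sum_cvg ab fI e'0.
have {cvg} := cvg _ (ltnSn N0); set N := N0.+1; set h := (b - a) / N%:R => cvg.
have h0 : 0 < h by rewrite divr_gt0 ?subr_gt0 ?ltr0Sn.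
have Nh : N%:R * h = b - a by rewrite mulrC divfK ?pnatr_eq0.
have /fin_all_exists [u Hu] : forall k : 'I_N, exists u : R * R,
    [/\ a + k%:R * h <= u.1 <= a + k.+1%:R * h,
        a + k%:R * h <= u.2 <= a + k.+1%:R * h & e < f u.1 - f u.2].
  move=> k; apply: contrapT => noosc; apply: no.
  have k0 : 0 <= k%:R * h by rewrite mulr_ge0 ?ler0n ?ltW.
  have kN : k.+1%:R * h <= N%:R * h.
    by apply: ler_wpM2r; rewrite ?ler_nat ?(ltW h0).
  move: kN noosc; rewrite -natr1 mulrDl mul1r => kN noosc.
  (* the middle third, so that the subinterval is interior to [a, b] *)
  exists (a + k%:R * h + h / 3), (a + k%:R * h + 2 * h / 3); split; try lra.
  move=> x y Hx Hy; rewrite leNgt; apply/negP => lt_e; apply: noosc.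
  move: lt_e; have [le_xy|le_yx] := ler0P (f x - f y) => lt_e.
    exists (y, x) => /=; split; lra.
  by exists (x, y) => /=; split; lra.
have /cvg S1 : in_cells a b (fun k => (u k).1) by move=> k; case: (Hu k).
have /cvg S2 : in_cells a b (fun k => (u k).2) by move=> k; case: (Hu k).
have : h * \sum_(k < N) (f (u k).1 - f (u k).2) >= h * \sum_(k < N) e.
  rewrite ler_pM2l //; apply: ler_sum => k _; by case: (Hu k) => _ _ /ltW.
rewrite sumr_const card_ord -[e *+ N]mulr_natl mulrA [h * _]mulrC Nh.
rewrite sumrB mulrBr.
move: S1 S2; rewrite !ltr_norml; lra.
Qed.

Lemma small_osc_family (T : eqType) (f : T -> R -> R) (s : seq T) (a b e : R) :
  a < b -> (forall i, ex_RInt (f i) a b) -> 0 < e ->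
  exists c d,
    [/\ a < c, c < d, d < b & forall i, i \in s -> osc_le (f i) c d e].
Proof.
move=> ab fab e0; elim: s => [|i s [c [d [ac cd db IHs]]]].
  by exists (a + (b - a) / 3), (a + 2 * (b - a) / 3); split=> //; lra.
have fcd : ex_RInt (f i) c d.
  by apply: (ex_RInt_subinterval _ _ _ (fab i)); exact: ltW.
have [c' [d' [cc' cd' dd' osci]]] := small_osc_subinterval cd fcd e0.
exists c', d'; split=> //; [exact: lt_trans cc'|exact: lt_trans db|].
move=> j; rewrite inE => /predU1P[-> //|/IHs oscj] x y Hx Hy.
by apply: oscj; lra.
Qed.

Definition common_continuity_pt (T : Type) (f : T -> R -> R) (x : R) : Prop :=
  forall e : R, 0 < e ->
  exists2 d, 0 < d & forall y, `|y - x| < d -> forall i, `|f i y - f i x| <= e.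

(** Nested intervals, each interior to the previous one, on which the
    oscillation of all the functions tends to [0]; their common point is a
    continuity point. *)
Lemma exists_common_continuity_pt (T : finType) (f : T -> R -> R) (a b : R) :
  a < b -> (forall i, ex_RInt (f i) a b) ->
  exists2 x, a < x < b & common_continuity_pt f x.
Proof.
move=> ab fab.
pose good (p : R * R) := [&& a <= p.1, p.1 < p.2 & p.2 <= b].
have /choice [step Hstep] : forall np : nat * {p | good p},
    exists q : {p | good p},
    [/\ (sval np.2).1 < (sval q).1, (sval q).2 < (sval np.2).2 &
        forall i, osc_le (f i) (sval q).1 (sval q).2 np.1.+1%:R^-1].
  move=> [n [p /= /and3P[ap lt_p pb]]].
  have fp i : ex_RInt (f i) p.1 p.2.
    by apply: ex_RInt_subinterval (fab i) => //; exact: ltW.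
  have n0 : 0 < n.+1%:R^-1 :> R by rewrite invr_gt0 ltr0Sn.
  have [c [d [pc cd dp osc]]] := small_osc_family (enum T) lt_p fp n0.
  have Hq : good (c, d) by apply/and3P; split=> /=; lra.
  by exists (exist _ (c, d) Hq); split=> //= i; apply: osc; rewrite mem_enum.
have good0 : good (a, b) by rewrite /good /= !lexx ab.
pose u := fix u n := if n is m.+1 then step (m, u m) else exist _ (a, b) good0.
have u1 n : (sval (u n)).1 < (sval (u n.+1)).1 by case: (Hstep (n, u n)).
have u2 n : (sval (u n.+1)).2 < (sval (u n)).2 by case: (Hstep (n, u n)).
have uosc n i : osc_le (f i) (sval (u n.+1)).1 (sval (u n.+1)).2 n.+1%:R^-1.
  by case: (Hstep (n, u n)).
have u1_mono : {homo (fun n => (sval (u n)).1) : m n / (m <= n)%N >-> m <= n}.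
  apply: homo_leq => [x|y x z|n]; [exact: lexx|exact: le_trans|exact/ltW].
have u2_mono : {homo (fun n => (sval (u n)).2) : m n / (m <= n)%N >-> n <= m}.
  apply: homo_leq => [x|y x z h1 h2|n].
  - exact: lexx.
  - exact: le_trans h2 h1.
  - exact/ltW.
have u12 m n : (sval (u m)).1 <= (sval (u n)).2.
  have := u1_mono _ _ (leq_maxl m n); have := u2_mono _ _ (leq_maxr m n).
  by case: (u (maxn m n)) => /= p /and3P[_ lt_p _]; lra.
have [|| x [ubx lubx]] := completeness (fun y => exists n, y = (sval (u n)).1).
- by exists (sval (u 0%N)).2 => _ [n ->]; apply/RleP.
- by exists (sval (u 0%N)).1, 0%N.
have ux n : (sval (u n)).1 < x < (sval (u n)).2.
  apply/andP; split.
    by apply: lt_le_trans (u1 n) _; apply/RleP/ubx; exists n.+1.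
  apply: le_lt_trans (u2 n); apply/RleP/lubx => _ [m ->]; exact/RleP.
exists x; first exact: ux 0%N.
move=> e e0.
have := archi_boundP (x := e^-1); rewrite invr_ge0 ltW // => /(_ isT).
set n := Num.Def.archi_bound _ => lt_n.
have ne : n.+1%:R^-1 <= e.
  rewrite invf_ple ?posrE ?ltr0Sn //; apply: le_trans (ltW lt_n) _.
  by rewrite ler_nat.
have /andP[ux1 ux2] := ux n.+1.
exists (Num.min (x - (sval (u n.+1)).1) ((sval (u n.+1)).2 - x)).
  by rewrite lt_min !subr_gt0 ux1.
move=> y; rewrite lt_min !ltr_norml => /andP[/andP[y1 _] /andP[_ y2]] i.
by apply: le_trans ne; apply: uosc; lra.
Qed.

(** * Row bases and matrix bounds *)

(** A free family that does not span can be extended, and the rank is at most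
    [M]. *)
Lemma exists_row_basis (F : fieldType) (T : Type) (M : nat) (D : T -> Prop)
    (g : T -> 'rV[F]_M) :
  exists (r : nat) (t : 'I_r -> T),
    [/\ forall j, D (t j), row_free (\matrix_j g (t j)) &
        forall x, D x -> (g x <= \matrix_j g (t j))%MS].
Proof.
apply: contrapT => no.
have free r : exists t : 'I_r -> T,
    (forall j, D (t j)) /\ row_free (\matrix_j g (t j)).
  elim: r => [|r [t [Dt freet]]].
    by exists (fun j : 'I_0 => False_rect T (notF (ltn_ord j))); split;
      [case|rewrite /row_free -leqn0 rank_leq_row].
  have [x Dx notin] : exists2 x, D x & ~~ (g x <= \matrix_j g (t j))%MS.
    apply: contrapT => span; apply: no; exists r, t; split=> // x Dx.
    by apply: contrapT => /negP notin; apply: span; exists x.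
  pose t' (i : 'I_(1 + r)) := if split i is inr j then t j else x.
  exists t'; split; first by move=> i; rewrite /t'; case: split.
  have -> : \matrix_i g (t' i) = col_mx (g x) (\matrix_j g (t j)).
    apply/row_matrixP => i; rewrite rowK /t' -(splitK i).
    case: (split i) => j; rewrite unsplitK /=.
      by rewrite rowKu [j]ord1 row_id.
    by rewrite rowKd rowK.
  rewrite /row_free eqn_leq rank_leq_row /=.
  have eqr : \rank (g x + \matrix_j g (t j))%MS =
             \rank (col_mx (g x) (\matrix_j g (t j))) by rewrite addsmxE.
  rewrite -eqr.
  apply: (@leq_ltn_trans (\rank (\matrix_j g (t j)))).
    by rewrite (eqP freet).
  apply: rank_ltmx; rewrite /ltmx addsmxSr /=.
  by apply: contra notin; apply: submx_trans; exact: addsmxSl.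
have [t [_]] := free M.+1; rewrite /row_free => /eqP eqM.
by have := rank_leq_col (\matrix_j g (t j)); rewrite eqM ltnn.
Qed.

Definition mx_abs_sum (m n : nat) (A : 'M[R]_(m, n)) : R :=
  \sum_i \sum_j `|A i j|.

Lemma mx_abs_sum_ge0 m n (A : 'M[R]_(m, n)) : 0 <= mx_abs_sum A.
Proof. by apply: sumr_ge0 => i _; apply: sumr_ge0. Qed.

Lemma norm_mulmx_le m n (v : 'rV[R]_m) (A : 'M[R]_(m, n)) (e : R) :
  (forall i, `|v 0 i| <= e) -> forall j, `|(v *m A) 0 j| <= e * mx_abs_sum A.
Proof.
move=> ve j; rewrite mxE mulr_sumr.
apply: le_trans (ler_norm_sum _ _ _) _; apply: ler_sum => i _.
rewrite normrM; apply: ler_pM => //.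
by rewrite (bigD1 j) //= lerDl sumr_ge0.
Qed.

(** * Riemann sums with tags in a dense set *)

Lemma is_RInt_indicator (a c d b : R) : a <= c -> c <= d -> d <= b ->
  is_RInt (fun x => (c < x < d)%R%:R : R) a b (d - c).
Proof.
move=> ac cd db.
have part (x y v : R) : x <= y ->
    (forall z, x < z < y -> (c < z < d)%R%:R = v) ->
    is_RInt (fun x => (c < x < d)%R%:R : R) x y ((y - x) * v).
  move=> /RleP xy H; apply: is_RInt_ext (is_RInt_const x y v) => z.
  rewrite Rmin_left // Rmax_right // => -[/RltP ? /RltP ?].
  exact/esym/H/andP.
have -> : d - c = (c - a) * 0 + (d - c) * 1 + (b - d) * 0 by ring.
apply: is_RInt_Chasles (part _ _ 0 db _); last first.
  by move=> z /andP[dz _]; rewrite [z < d]ltNge (ltW dz) andbF.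
apply: is_RInt_Chasles (part _ _ 0 ac _) (part _ _ 1 cd _).
  by move=> z /andP[_ zc]; rewrite [c < z]ltNge (ltW zc).
by move=> z ->.
Qed.

Lemma Riemann_sum_tags_in (T : finType) (F : T -> R -> R) (I : T -> R)
    (a b : R) (D : R -> Prop) :
  a < b -> (forall i, is_RInt (F i) a b (I i)) ->
  (forall c d, a <= c -> c < d -> d <= b -> exists2 x, c < x < d & D x) ->
  forall e : R, 0 < e ->
  exists (N : nat) (s : 'I_N -> R), (forall k, D (s k)) /\
    forall i, `|(b - a) / N%:R * (\sum_(k < N) F i (s k)) - I i| < e.
Proof.
move=> ab FI Ddense e e0.
have /fin_all_exists [N0 HN0] i := uniform_Riemann_sum_cvg ab (FI i) e0.
pose N := (\max_i N0 i).+1.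
set h := (b - a) / N%:R.
have h0 : 0 < h by rewrite divr_gt0 ?subr_gt0 ?ltr0Sn.
have Nh : N%:R * h = b - a by rewrite mulrC divfK ?pnatr_eq0.
have /fin_all_exists2 [s Hs Ds] : forall k : 'I_N,
    exists2 x, a + k%:R * h < x < a + k.+1%:R * h & D x.
  move=> k; apply: Ddense.
  - by rewrite lerDl mulr_ge0 ?ler0n ?ltW.
  - by rewrite ltrD2l ltr_pM2r // ltr_nat.
  - by rewrite -lerBrDl -Nh ler_pM2r // ler_nat.
exists N, s; split=> // i; apply: HN0; first by rewrite ltnS leq_bigmax.
by move=> k; have /andP[? ?] := Hs k; rewrite !ltW.
Qed.

Lemma finite_pos_lower_bound (T : finType) (d : T -> R) :
  (forall i, 0 < d i) -> exists2 e, 0 < e & forall i, e <= d i.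
Proof.
move=> d0; exists (\big[Num.min/1]_i d i).
  by apply: lt_bigmin.
by move=> i; apply: bigmin_le_cond.
Qed.

(** * Integrals of maps into convex cones *)

Definition interior_continuity_pt (M : nat) (g : R -> 'rV[R]_M) (a b x : R) :
    Prop :=
  a < x < b /\ common_continuity_pt (fun i y => g y 0 i) x.

Lemma common_continuity_pts_dense (M : nat) (g : R -> 'rV[R]_M)
    (p : 'rV[R]_M) (a b : R) :
  (forall i, is_RInt (fun x => g x 0 i) a b (p 0 i)) ->
  forall c d, a <= c -> c < d -> d <= b ->
  exists2 x, c < x < d & interior_continuity_pt g a b x.
Proof.
move=> gp c d ac cd db.
have gcd i : ex_RInt (fun x => g x 0 i) c d.
  by apply: (@ex_RInt_subinterval _ a c d b) => //; [exact: ltW|exists (p 0 i)].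
have [x Hx ctx] := exists_common_continuity_pt cd gcd.
by exists x => //; split=> //; lra.
Qed.

(** A linear relation satisfied by [g] on a dense set passes to Riemann sums
    with tags in that set, hence to their limit. With [Q] a projection onto a
    subspace, this says that the integral stays in the subspace. *)
Lemma RInt_in_span (M : nat) (g : R -> 'rV[R]_M) (p : 'rV[R]_M) (a b : R)
    (Q : 'M[R]_M) :
  a < b -> (forall i, is_RInt (fun x => g x 0 i) a b (p 0 i)) ->
  (forall x, interior_continuity_pt g a b x -> g x *m Q = g x) -> p *m Q = p.
Proof.
move=> ab gp gQ; apply/eqP; rewrite -subr_eq0; apply/eqP/rowP => i.
rewrite [RHS]mxE; apply/eqP; rewrite -normr_le0.
apply/ler_addgt0Pl => e e0; rewrite addr0.
pose C := mx_abs_sum (Q - 1%:M) + 1.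
have C0 : 0 < C by rewrite ltr_pwDr // mx_abs_sum_ge0.
have [N [s [Ds Hs]]] := Riemann_sum_tags_in ab gp
  (common_continuity_pts_dense gp) (divr_gt0 e0 C0).
pose S := (b - a) / N%:R *: \sum_(k < N) g (s k).
have SQ : S *m Q = S.
  rewrite -scalemxAl mulmx_suml; congr (_ *: _).
  by apply: eq_bigr => k _; exact: gQ.
have -> : p *m Q - p = (p - S) *m (Q - 1%:M).
  by rewrite mulmxBr mulmx1 mulmxBl SQ opprB addrA subrK.
have pS j : `|(p - S) 0 j| <= e / C.
  by have := Hs j; rewrite distrC !mxE summxE => /ltW.
apply: le_trans (norm_mulmx_le _ pS _) _.
by rewrite mulrAC ler_pdivrMr // ler_pM2l // lerDl.
Qed.

(** The proof exhibits [p] as a conic combination of finitely many values of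
    [g] at interior continuity points: those at the tags [s k], with their
    weight reduced by the factor [1 - phi (s k)], and those at the [t j], whose
    coefficients [c 0 j] collect the remaining weight and the error of the
    Riemann sum. *)
Theorem RInt_in_convex_cone (M : nat) (g : R -> 'rV[R]_M) (p : 'rV[R]_M)
    (a b : R) (K : 'rV[R]_M -> Prop) :
  a < b -> (forall i, is_RInt (fun x => g x 0 i) a b (p 0 i)) ->
  (forall u v, K u -> K v -> K (u + v)) ->
  (forall c u, 0 <= c -> K u -> K (c *: u)) ->
  (forall x, a < x < b -> K (g x)) -> K p.
Proof.
move=> ab gp KD KZ Kg.
have K0 : K 0.
  have mid : a < (a + b) / 2 < b by lra.
  by rewrite -(scale0r (g ((a + b) / 2))); apply/KZ/Kg.
have Ksum N (F : 'I_N -> 'rV[R]_M) : (forall k, K (F k)) -> K (\sum_k F k).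
  by move=> KF; apply: big_ind.
have [r [t [Dt /mulmxVp freeB spanB]]] :=
  exists_row_basis (interior_continuity_pt g a b) g.
move: freeB spanB; set B := \matrix_j g (t j); set A := pinvmx B => BA spanB.
pose coef x := g x *m A.
have coefB x : interior_continuity_pt g a b x -> coef x *m B = g x.
  by move/spanB/mulmxKpV.
have coef_t j k : coef (t j) 0 k = (j == k)%:R.
  by rewrite /coef -[g (t j)](rowK (fun j => g (t j))) -row_mul BA !mxE.
have pAB : p *m A *m B = p.
  by rewrite -mulmxA; apply: (RInt_in_span ab gp) => x /coefB; rewrite mulmxA.
have [q qE] : exists q : R, q = r.+1%:R by exists r.+1%:R.
have q0 : 0 < q by rewrite qE ltr0Sn.
have q_neq0 : q != 0 by rewrite gt_eqF.
pose C := mx_abs_sum A + 1.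
have C0 : 0 < C by rewrite ltr_pwDr // mx_abs_sum_ge0.
(* the off-diagonal loss is at most [eta * \sum_i X i <= eta * (3 * d * q)],
   half of the lower bound [d] of the diagonal contribution [X j] below *)
pose eta := (6 * q)^-1.
have eta0 : 0 < eta by rewrite invr_gt0 mulr_gt0.
have /fin_all_exists2 [rad rad0 Hrad] : forall j, exists2 d, 0 < d &
    forall y, `|y - t j| < d -> forall k, `|coef y 0 k - (j == k)%:R| <= eta.
  move=> j; have [_ /(_ _ (divr_gt0 eta0 C0)) [d d0 Hd]] := Dt j.
  exists d => // y /Hd Hy k; rewrite -coef_t.
  have -> : coef y 0 k - coef (t j) 0 k = ((g y - g (t j)) *m A) 0 k.
    by rewrite mulmxBl !mxE.
  apply: le_trans (norm_mulmx_le (e := eta / C) _ _ _) _.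
    by move=> i; rewrite !mxE.
  by rewrite mulrAC ler_pdivrMr // ler_pM2l // lerDl.
have [d d0 Hd] : exists2 d, 0 < d &
    forall j, d <= Num.min (rad j) (Num.min (t j - a) (b - t j)).
  apply: finite_pos_lower_bound => j; rewrite !lt_min rad0 !subr_gt0.
  by have [/andP[-> ->]] := Dt j.
(* [chi j] selects the tags near [t j], where the coordinates of [g] are within
   [eta] of the [j]-th unit vector *)
pose chi j x : R := (t j - d < x < t j + d)%R%:R.
have chi_int j : is_RInt (chi j) a b (2 * d).
  have := Hd j; rewrite !le_min => /and3P[_ ad db].
  have -> : 2 * d = (t j + d) - (t j - d) by ring.
  by apply: is_RInt_indicator; lra.
have chi_coef i j x : chi i x * ((i == j)%:R - eta) <= chi i x * coef x 0 j.
  rewrite {1 2}/chi; case: andP => [[x1 x2]|]; last by rewrite !mul0r.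
  rewrite !mul1r.
  have : `|x - t i| < rad i.
    by have := Hd i; rewrite !le_min => /and3P[? _ _]; rewrite ltr_norml; lra.
  by move/(Hrad i)/(_ j); rewrite ler_norml; lra.
(* small enough for the error in the basis to stay below [d / (2 * q)] *)
pose e := d / (2 * q * C).
have e0 : 0 < e by rewrite divr_gt0 // !mulr_gt0.
have e_le : e * mx_abs_sum A <= d / (2 * q).
  rewrite /e invfM mulrA mulrAC ler_pdivrMr // ler_wpM2l ?lerDl //.
  by rewrite divr_ge0 ?ltW // mulr_gt0.
have ed : e <= d.
  rewrite ler_pdivrMr ?mulr_gt0 // ler_peMr ?(ltW d0) //.
  rewrite -[1]mulr1; apply: ler_pM => //; last by rewrite lerDr mx_abs_sum_ge0.
  have : 1 <= q by rewrite qE ler1n.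
  lra.
(* one subdivision serves for the coordinates of [g] and for the amounts of
   weight near the [t j] *)
pose F (u : 'I_M + 'I_r) x :=
  match u with inl i => g x 0 i | inr j => chi j x end.
pose I (u : 'I_M + 'I_r) := match u with inl i => p 0 i | inr _ => 2 * d end.
have FI u : is_RInt (F u) a b (I u) by case: u.
have [N [s [Ds Hs]]] :=
  Riemann_sum_tags_in ab FI (common_continuity_pts_dense gp) e0.
set h := (b - a) / N%:R in Hs.
have h0 : 0 <= h by rewrite divr_ge0 ?ler0n // subr_ge0 ltW.
pose S := h *: \sum_(k < N) g (s k).
have err j : `|((p - S) *m A) 0 j| <= d / (2 * q).
  apply: le_trans e_le; apply: norm_mulmx_le => i.
  by have := Hs (inl i); rewrite distrC !mxE summxE => /ltW.
pose X j := h * \sum_(k < N) chi j (s k).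
have X_ge j : d <= X j.
  by have := Hs (inr j); rewrite /F /I -/(X j) ltr_norml; lra.
have X_le j : X j <= 3 * d.
  by have := Hs (inr j); rewrite /F /I -/(X j) ltr_norml; lra.
(* the share of the weight of a tag that is rewritten in the basis; dividing by
   [q] keeps it at most [1] even where the intervals around the [t j] overlap
   *)
pose phi x := q^-1 * \sum_j chi j x.
have phi_le1 x : phi x <= 1.
  rewrite /phi mulrC ler_pdivrMr // mul1r.
  apply: (@le_trans _ _ (\sum_(j < r) 1)); last first.
    by rewrite sumr_const card_ord qE ler_nat.
  by apply: ler_sum => j _; rewrite /chi; case: (_ && _); rewrite ?ler01.
pose c := (p - S) *m A + h *: \sum_(k < N) phi (s k) *: coef (s k).
have c_ge0 j : 0 <= c 0 j.
  have main : d / 2 <= q * (h *: \sum_(k < N) phi (s k) *: coef (s k)) 0 j.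
    have -> : q * (h *: \sum_(k < N) phi (s k) *: coef (s k)) 0 j =
        h * \sum_(k < N) \sum_i chi i (s k) * coef (s k) 0 j.
      rewrite mxE summxE mulrCA; congr (_ * _); rewrite mulr_sumr.
      apply: eq_bigr => k _.
      rewrite mxE /phi mulrA mulrA divff ?gt_eqF // mul1r.
      by rewrite mulr_suml.
    have le_X : X j - eta * \sum_i X i <=
        h * \sum_(k < N) \sum_i chi i (s k) * coef (s k) 0 j.
      have -> : X j - eta * \sum_i X i =
          h * \sum_(k < N) \sum_i chi i (s k) * ((i == j)%:R - eta).
        rewrite exchange_big /= mulr_sumr.
        rewrite [X j](_ : _ = \sum_i X i * (i == j)%:R).
          rewrite mulr_sumr -sumrB; apply: eq_bigr => i _.
          by rewrite -mulr_suml mulrA -/(X i); ring.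
        rewrite (bigD1 j) //= eqxx mulr1 big1 ?addr0 // => i /negbTE ->.
        by rewrite mulr0.
      apply: ler_wpM2l => //; apply: ler_sum => k _; apply: ler_sum => i _.
      exact: chi_coef.
    apply: le_trans le_X.
    have : eta * \sum_i X i <= eta * (3 * d * q).
      rewrite ler_pM2l //; apply: (@le_trans _ _ (\sum_(i < r) 3 * d)).
        exact: ler_sum.
      rewrite sumr_const card_ord -[leLHS]mulr_natr ler_pM2l ?mulr_gt0 //.
      by rewrite qE ler_nat.
    have -> : eta * (3 * d * q) = d / 2.
      by rewrite /eta; field.
    by have := X_ge j; lra.
  have := err j; rewrite ler_norml => /andP[err_j _].
  rewrite mxE -(pmulr_rge0 _ q0) mulrDr.
  have := ler_wpM2l (ltW q0) err_j.
  have -> : q * - (d / (2 * q)) = - (d / 2) by field.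
  by move: main; lra.
have -> : p = h *: (\sum_(k < N) (1 - phi (s k)) *: g (s k)) +
    \sum_j c 0 j *: g (t j).
  have -> : \sum_j c 0 j *: g (t j) = c *m B.
    by rewrite mulmx_sum_row; apply: eq_bigr => j _; rewrite rowK.
  have phiB : (\sum_(k < N) phi (s k) *: coef (s k)) *m B =
      \sum_(k < N) phi (s k) *: g (s k).
    by rewrite mulmx_suml; apply: eq_bigr => k _; rewrite -scalemxAl coefB.
  have SAB : S *m A *m B = S.
    rewrite -mulmxA -scalemxAl mulmx_suml; congr (_ *: _).
    by apply: eq_bigr => k _; rewrite mulmxA coefB.
  rewrite mulmxDl -scalemxAl phiB !mulmxBl pAB SAB addrCA -scalerDr.
  rewrite -big_split /=.
  under eq_bigr => k _ do rewrite -scalerDl subrK scale1r.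
  by rewrite subrK.
apply: KD.
  apply: (KZ) => //; apply: (Ksum) => k; apply: (KZ); first by rewrite subr_ge0.
  by apply: (Kg); case: (Ds k).
by apply: (Ksum) => j; apply: (KZ) => //; apply: (Kg); case: (Dt j).
Qed.

(** * The cone of SONC polynomials *)

Lemma SONC_coneD (n k : nat) (p q : {mpoly R[n]}) :
  SONC_cone k p -> SONC_cone k q -> SONC_cone k (p + q).
Proof.
move=> [degp [s Hs defp]] [degq [u Hu defq]]; split.
  by apply: leq_trans (msizeD_le p q) _; rewrite geq_max; apply/andP.
exists (s ++ u); last by rewrite big_cat defp defq.
by move=> v; rewrite mem_cat => /orP[/Hs|/Hu].
Qed.

Lemma SONC_coneZ (n k : nat) (c : R) (p : {mpoly R[n]}) :
  0 <= c -> SONC_cone k p -> SONC_cone k (c *: p).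
Proof.
move=> c0 [degp [s Hs defp]]; split.
  exact: leq_trans (msizeZ_le _ _) degp.
exists [seq (c * u.1, u.2) | u <- s].
  by move=> _ /mapP[u /Hs[u0 circ nneg] ->]; split=> //; exact: mulr_ge0.
by rewrite defp big_map scaler_sumr; apply: eq_bigr => u _; rewrite scalerA.
Qed.

Unset Implicit Arguments.

Theorem lemma4p2 (n d : nat) (f : R -> {mpoly R[n]})
    (hf : forall t : R, 0 <= t <= 1 -> SONC_cone (2 * d) (f t))
    (hint : poly_ex_RInt f 0 1) :
  SONC_cone (2 * d) (poly_RInt (2 * d) f 0 1).
Proof.
pose T : finType := 'X_{1..n < (2 * d).+1}.
pose poly_of (v : 'rV[R]_#|T|) : {mpoly R[n]} :=
  \sum_i v 0 i *: 'X_[bmnm (enum_val i : T)].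
pose g t : 'rV[R]_#|T| := \row_i (f t)@_(bmnm (enum_val i : T)).
have reidx (F : T -> {mpoly R[n]}) :
    \sum_m F m = \sum_(i < #|T|) F (enum_val i).
  by rewrite (reindex (@enum_val T T)) //; apply/onW_bij/enum_val_bij.
pose p : 'rV[R]_#|T| :=
  \row_i RInt (fun t => (f t)@_(bmnm (enum_val i : T))) 0 1.
have -> : poly_RInt (2 * d) f 0 1 = poly_of p.
  rewrite /poly_RInt (reidx (fun m => _ *: _)).
  by apply: eq_bigr => i _; rewrite mxE.
have gp i : is_RInt (fun t => g t 0 i) 0 1 (p 0 i).
  rewrite mxE; apply: is_RInt_ext (RInt_correct _ _ _ (hint _)) => t _.
  by rewrite mxE.
apply: (@RInt_in_convex_cone _ g p 0 1 (SONC_cone (2 * d) \o poly_of) ltr01 gp)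
  => /=.
- move=> u v Ku Kv; have -> : poly_of (u + v) = poly_of u + poly_of v.
    by rewrite /poly_of -big_split; apply: eq_bigr => i _; rewrite mxE scalerDl.
  exact: SONC_coneD.
- move=> c u c0 Ku; have -> : poly_of (c *: u) = c *: poly_of u.
    by rewrite /poly_of scaler_sumr; apply: eq_bigr => i _; rewrite mxE scalerA.
  exact: SONC_coneZ.
move=> t /andP[t0 t1].
have ft : SONC_cone (2 * d) (f t) by apply: hf; rewrite !ltW.
have -> : poly_of (g t) = f t; last by [].
have [degf _] := ft; rewrite [RHS](mpolywE degf).
rewrite (reidx (fun m => _ *: _)).
by apply: eq_bigr => i _; rewrite mxE.
Qed.
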